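(* Under the setting and assumptions (S1), (S2), (B1)–(B6) listed in the context, for every $\delta\in[0,1)$ the optimal design problem of minimizing $J(\mathfrak a,u)$ over $(\mathfrak a,u)\in\mathcal Z^\delta$ has a solution; that is, there is $(\overline{\mathfrak a}_\delta,\overline u_\delta)\in\mathcal Z^\delta$ with $J(\overline{\mathfrak a}_\delta,\overline u_\delta)\le J(\mathfrak a,u)$ for all $(\mathfrak a,u)\in\mathcal Z^\delta$.
   Context: Setting. $(\mathcal H,d)$ is a nonempty compact metric space (the design space). $X_0$ and $X_1$ are real Hilbert spaces with $X_0$ compactly embedded and dense in $X_1$; $\langle\cdot,\cdot\rangle$ is the inner product of $X_1$. $\{X_\delta\}_{\delta\in[0,1]}$ is a family of Hilbert spaces (whose end points, at $\delta=0$ and $\delta=1$, are the Hilbert spaces $X_0$ and $X_1$, with $X_0$ compactly embedded and dense in $X_1$) such that $X_{\delta_1}\hookrightarrow X_{\delta_2}$ continuously (viewed as an inclusion) whenever $\delta_1<\delta_2$ in $[0,1]$, with embedding constant independent of $\delta_1,\delta_2$. $f\in X_1$ is fixed. For each $\delta\in[0,1)$, $\mathfrak B_\delta$ maps each $\mathfrak a\in\mathcal H$ to a bounded symmetric bilinear form $\mathfrak B_\delta[\mathfrak a]$ on $X_\delta$. The energy is $E_\delta[\mathfrak a](w)=\frac12\mathfrak B_\delta[\mathfrak a](w,w)-\langle f,w\rangle$, $w\in X_\delta$. The admissible set is $\mathcal Z^\delta=\{(\mathfrak a,u)\in\mathcal H\times X_\delta: u\in\operatorname{argmin}_{w\in X_\delta}E_\delta[\mathfrak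 a](w)\}$; equivalently $\mathfrak B_\delta[\mathfrak a](u,v)=\langle f,v\rangle$ for all $v\in X_\delta$. The function $\phi:\mathcal H\to\mathbb R$ is non-negative, convex and lower semicontinuous (convexity refers to a convex structure of $\mathcal H$ when it carries one; none is otherwise assumed). The objective is $J(\mathfrak b,w)=\langle f,w\rangle+\phi(\mathfrak b)$ for $\mathfrak b\in\mathcal H$, $w\in X_1$. Assumptions. (S1) There is $M>0$ with $\|v\|_{X_1}\le M\|v\|_{X_\delta}$ for all $\delta\in[0,1)$, $v\in X_\delta$. (S2) If $v_\delta\in X_\delta$ for $\delta\in(0,1)$ and $\|v_\delta\|_{X_\delta}$ stays bounded as $\delta\downarrow0$, then $\{v_\delta\}$ is relatively compact in $X_1$ and any limit point (as $\delta\downarrow0$) belongs to $X_0$. (B1) For every $\delta\in[0,1)$: if $\mathfrak a_j\to\mathfrak a$ in $(\mathcal H,d)$, then $\mathfrak B_\delta[\mathfrak a_j](v,v)\to\mathfrak B_\delta[\mathfrak a](v,v)$ for every $v\in X_\delta$. (B2) There is $A>0$ with $|\mathfrak B_\delta[\mathfrak a](v,v)|\le A\|v\|_{X_\delta}^2$ for all $\delta\in[0,1)$, $\mathfrak a\in\mathcal H$, $v\in X_\delta$. (B3) There is $\alpha>0$ with $\alpha\|v\|_{X_\delta}^2\le\mathfrak B_\delta[\mathfrak a](v,v)$ for all $\delta\in[0,1)$, $\mathfrak a\in\mathcal H$, $v\in X_\delta$. (B4) If $\mathfrak a_\delta\to\mathfrak a$ in $(\mathcal H,d)$ as $\delta\downarrow0$,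 then $\mathfrak B_\delta[\mathfrak a_\delta](v,w)-\mathfrak B_\delta[\mathfrak a](v,w)\to0$ as $\delta\downarrow0$ for all $v,w\in X_0$. (B5) $\lim_{\delta\downarrow0}\mathfrak B_\delta[\mathfrak a](v,w)=\mathfrak B_0[\mathfrak a](v,w)$ for all $\mathfrak a\in\mathcal H$, $v,w\in X_0$. (B6) If $\mathfrak a\in\mathcal H$, $v_\delta\in X_\delta$, $v\in X_0$ and $v_\delta\to v$ in $X_1$ as $\delta\downarrow0$, then $\mathfrak B_0[\mathfrak a](v,v)\le\liminf_{\delta\downarrow0}\mathfrak B_\delta[\mathfrak a](v_\delta,v_\delta)$. *)

(* Defs.v *)
From HB Require Import structures.
From mathcomp Require Import all_boot all_order all_algebra.
From mathcomp Require Import all_classical all_reals all_analysis.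

Set Implicit Arguments.
Unset Strict Implicit.
Unset Printing Implicit Defensive.

Import Order.TTheory GRing.Theory Num.Theory.
Import numFieldNormedType.Exports.

Local Open Scope classical_set_scope.
Local Open Scope ring_scope.

HB.mixin Record CompleteNormedModule_isHilbert (R : realType) V
    & CompleteNormedModule R V := {
  inner : {dot V for idfun} ;
  inner_norm : forall x : V, inner x x = `|x| ^+ 2
}.

#[short(type="hilbertType")]
HB.structure Definition Hilbert (R : realType) :=
  {V of CompleteNormedModule R V & CompleteNormedModule_isHilbert R V}.

Definition convex_fun (R : realType) (T : Type) (c : isConvexSpace R T)
    (phi : T -> R) : Prop :=
  forall (t : {i01 R}) (x y : T),
    phi (isConvexSpace.conv c t x y) <= t%:num * phi x + (1 - t%:num) * phi y.

Definition argmin (R : realType) (T : Type) (F : T -> R) : set T :=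
  [set u | forall w, F u <= F w].

Definition compact_map (R : realType) (V W : normedModType R) (g : V -> W) :
    Prop :=
  forall A : set V, bounded_set A -> precompact (g @` A).

(* A scale is a family of Hilbert spaces indexed by R, of which only the
   indices in [0, 1] matter. For s <= t in [0, 1] the map [emb s t] plays the
   role of the inclusion of X s in X t; in particular [emb s 1] views the
   elements of X s as elements of X 1. Outside of s <= t in [0, 1] the maps
   [emb s t] are unconstrained (they may be zero). *)
Definition hilbert_scale (R : realType) (X : R -> hilbertType R)
    (emb : forall s t : R, {linear X s -> X t}) : Prop :=
  [/\ forall s, 0 <= s -> s <= 1 -> forall x, emb s s x = x,
      forall s t u, 0 <= s -> s <= t -> t <= u -> u <= 1 ->
        forall x, emb t u (emb s t x) = emb s u x,
      forall s t, 0 <= s -> s <= t -> t <= 1 -> injective (emb s t) &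
      exists C : R, forall s t, 0 <= s -> s < t -> t <= 1 ->
        forall x, `|emb s t x| <= C * `|x|].

Definition bounded_form (R : realType) (V : normedModType R)
    (b : V -> V -> R) : Prop :=
  exists C : R, forall v w, `|b v w| <= C * `|v| * `|w|.

Section design_problem.
Context (R : realType) (H : Type) (X : R -> hilbertType R).
Variables (emb : forall s t : R, {linear X s -> X t}) (f : X 1).
Variables (B : forall d : R, H -> {symmetric (X d)}) (phi : H -> R).

Definition energy (d : R) (a : H) (w : X d) : R :=
  2^-1 * B d a w w - inner f (emb d 1 w).

Definition admissible (d : R) : set (H * X d) :=
  [set p | argmin (energy p.1) p.2].

Definition objective (b : H) (w : X 1) : R := inner f w + phi b.

End design_problem.

(* Main.v *)
(* For fixed d the energy of a design a has a minimizer u_a, and testing the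
   Euler equation with u_a gives
     <f, u_a> = B[a](u_a, u_a) = sup_w (2 <f, w> - B[a](w, w)).
   By (B1) the right-hand side is a supremum of continuous functions of a, so
   the reduced cost a |-> <f, u_a> + phi a is lower semicontinuous, and it
   attains its minimum on the compact design space. No convergence of the
   states u_a is involved. *)
Require Import Defs.
From HB Require Import structures.
From mathcomp Require Import all_boot all_order all_algebra.
From mathcomp Require Import all_classical all_reals all_analysis.
From mathcomp Require Import ring lra.

Set Implicit Arguments.
Unset Strict Implicit.
Unset Printing Implicit Defensive.

Import Order.TTheory GRing.Theory Num.Theory.
Import numFieldNormedType.Exports.

Local Open Scope classical_set_scope.
Local Open Scope ring_scope.

Lemma lower_semicontinuous_compact_min (R : realType) (T : topologicalType)
    (F : T -> R) :
  [set: T] !=set0 -> compact [set: T] -> lower_semicontinuous (EFin \o F) ->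
  exists a, forall x, F a <= F x.
Proof.
move=> [x0 _] cT lscF.
(* The sublevel sets of F form a filter base, and its cluster points are
   exactly the minimizers. *)
pose G := filter_from [set: T] (fun x => [set y | F y <= F x]).
have FG : ProperFilter G.
  apply: filter_from_proper => [|x _]; last by exists x => /=.
  apply: filter_from_filter => [|x y _ _]; first by exists x0.
  have [xy|/ltW yx] := leP (F x) (F y).
    by exists x => // z /= zx; split=> //=; exact: le_trans xy.
  by exists y => // z /= zy; split=> //=; exact: le_trans yx.
have [a [_ Ga]] := cT G FG filterT.
exists a => x; rewrite leNgt; apply/negP => ltxa.
have [V aV VF] := lscF a (F x) ltxa.
have Gx : G [set y | F y <= F x] by exists x.
have [y [/= yx /VF]] := Ga _ _ Gx aV.
by rewrite /= lte_fin ltNge yx.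
Qed.

(** Passes from sequential continuity, the form of (B1), to neighbourhoods: counterexamples picked
    in the balls of radius [1 / (n + 1)] would form a sequence tending to [a]. *)
Lemma near_cvg_seq (R : realType) (T : pseudoMetricType R) (a : T)
    (P : set T) :
  (forall u : nat -> T, u @ \oo --> a -> \forall n \near \oo, P (u n)) ->
  \forall x \near a, P x.
Proof.
move=> seqP; apply: contrapT => nP.
have pick n : exists x, ball a n.+1%:R^-1 x /\ ~ P x.
  apply: contrapT => /forallNP h; apply: nP.
  apply/nbhs_ballP; exists n.+1%:R^-1 => /=; first by rewrite invr_gt0.
  by move=> x ax; apply: contrapT => Px; exact: (h x).
have [u uP] := choice pick.
have ua : u @ \oo --> a.
  apply/cvg_ballP => e e0; near=> n.
  apply: le_ball (uP n).1; apply: ltW.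
  by near: n; exact: near_infty_natSinv_lt (PosNum e0).
by have [n _ /(_ n (leqnn n))] := seqP u ua; exact: (uP n).2.
Unshelve. all: by end_near. Qed.

Lemma symmetric_sqrD (R : realType) (V : lmodType R) (b : {symmetric V})
    (u v : V) : b (u + v) (u + v) = b u u + 2 * b u v + b v v.
Proof. by rewrite (hnormD b) /= expr0 mul1r; ring. Qed.

Lemma symmetric_sqrB (R : realType) (V : lmodType R) (b : {symmetric V})
    (u v : V) : b (u - v) (u - v) = b u u - 2 * b u v + b v v.
Proof. by rewrite (hnormB b) /= expr0 mul1r; ring. Qed.

Lemma symmetric_sqrZ (R : realType) (V : lmodType R) (b : {symmetric V})
    (t : R) (u : V) : b (t *: u) (t *: u) = t ^+ 2 * b u u.
Proof. by rewrite linearZl_LR /= linearZr_LR /=; ring. Qed.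

(** Cauchy-Schwarz. The triangle inequality comes with the norm, so it suffices to square it and
    expand. *)
Lemma inner_le_norm (R : realType) (V : hilbertType R) (x y : V) :
  `|inner x y| <= `|x| * `|y|.
Proof.
have le_inner (z : V) : inner x z <= `|x| * `|z|.
  have hD : inner (x + z) (x + z) = inner x x + 2 * inner x z + inner z z.
    exact: symmetric_sqrD.
  have hB : inner (x - z) (x - z) = inner x x - 2 * inner x z + inner z z.
    exact: symmetric_sqrB.
  move: hD hB; rewrite !inner_norm => hD hB.
  have := ler_normD x z; have := ler_dist_dist x z.
  rewrite ler_norml => /andP[].
  have := normr_ge0 x; have := normr_ge0 z; have := normr_ge0 (x + z).
  have := normr_ge0 (x - z); nra.
by rewrite ler_norml le_inner andbT lerNl -linearNr -(normrN y) le_inner.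
Qed.

Section quadratic_energy.
Context (R : realType) (V : completeNormedModType R).
Variables (b : {symmetric V}) (g : {scalar V}).

Definition quad_energy (w : V) : R := 2^-1 * b w w - g w.

Lemma quad_energyD (u h : V) :
  quad_energy (u + h) = quad_energy u + (b u h - g h) + 2^-1 * b h h.
Proof. by rewrite /quad_energy symmetric_sqrD linearD; field. Qed.

(** The parallelogram law for [b]; the linear term averages exactly. The defect measures how far
    apart two near-minimizers can be. *)
Lemma quad_energy_midpoint (u v : V) :
  quad_energy (2^-1 *: (u + v)) =
    2^-1 * (quad_energy u + quad_energy v) - 8^-1 * b (u - v) (u - v).
Proof.
rewrite /quad_energy symmetric_sqrZ symmetric_sqrD symmetric_sqrB.
by rewrite linearZ linearD /=; field.
Qed.

(** Along the line [u + t *: u] the energy gain is a quadratic in [t] that is never negative, so its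
    linear coefficient vanishes. *)
Lemma argmin_quad_energy (u : V) : argmin quad_energy u -> b u u = g u.
Proof.
move=> minu.
have scaled (t : R) : 0 <= t * (b u u - g u) + 2^-1 * t ^+ 2 * b u u.
  have := minu (u + t *: u).
  by rewrite quad_energyD symmetric_sqrZ linearZr_LR linearZ /=; lra.
have D : 0 < (1 + `|b u u|)^-1 by rewrite invr_gt0 ltr_wpDr.
have DK : (1 + `|b u u|)^-1 * (1 + `|b u u|) = 1.
  by rewrite mulVf// gt_eqF// ltr_wpDr.
apply/eqP; rewrite -subr_eq0; apply/eqP.
(* A step against the slope [q], so short that the quadratic term cancels at most half of the linear
   gain; the gain is then a negative multiple of [q ^+ 2]. *)
have := scaled (- (b u u - g u) * (1 + `|b u u|)^-1).
have := ler_norm (b u u); move: D DK.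
set s := (1 + _)^-1; set B := `|_|; set p := b u u; set q := p - g u.
move=> s0 sB pB.
have -> : - q * s * q + 2^-1 * (- q * s) ^+ 2 * p
   = (- q ^+ 2 * s) * (1 - 2^-1 * (s * p)) by ring.
have sp : s * p <= 1.
  by rewrite -sB ler_pM2l//; lra.
have : 0 < s * (1 - 2^-1 * (s * p)) by rewrite mulr_gt0//; lra.
set r := s * _ => r0.
rewrite -mulrA -/r mulNr oppr_ge0 pmulr_lle0// => q2.
by apply/eqP; rewrite -sqrf_eq0 eq_le q2 sqr_ge0.
Qed.

Variables (C K alpha : R).
Hypothesis b_bounded : forall v w, `|b v w| <= C * `|v| * `|w|.
Hypothesis g_bounded : forall v, `|g v| <= K * `|v|.
Hypothesis alpha_gt0 : 0 < alpha.
Hypothesis b_coercive : forall v, alpha * `|v| ^+ 2 <= b v v.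

(** Complete the square in the norm of [w] around [K / alpha]. *)
Lemma quad_energy_lbound (w : V) : - (K ^+ 2 / (2 * alpha)) <= quad_energy w.
Proof.
have := b_coercive w; have := g_bounded w; rewrite ler_norml => /andP[_ gw] bw.
have -> : K ^+ 2 / (2 * alpha) = alpha * (K / alpha) ^+ 2 / 2.
  by field; rewrite gt_eqF.
have KE : K = alpha * (K / alpha) by field; rewrite gt_eqF.
move: gw; rewrite {1}KE /quad_energy; set k := K / alpha => gw.
have : 0 <= alpha * (`|w| - k) ^+ 2 by rewrite mulr_ge0 ?sqr_ge0 // ltW.
by rewrite sqrrB; nra.
Qed.

(* By the parallelogram law the near-minimizers form a Cauchy filter. *)
Lemma argmin_quad_energy_nonempty : argmin quad_energy !=set0.
Proof.
set m := inf (range quad_energy).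
have hasE : has_inf (range quad_energy).
  split; first by exists (quad_energy 0), 0.
  by exists (- (K ^+ 2 / (2 * alpha))) => _ [w _ <-]; exact: quad_energy_lbound.
have mE w : m <= quad_energy w by apply: ge_inf; [exact: hasE.2|exists w].
have near_min e : 0 < e -> exists w, quad_energy w < m + e.
  by move=> /inf_adherent/(_ hasE)[_ [w _ <-]]; exists w.
pose F := filter_from [set e : R | 0 < e]
  (fun e => [set w | quad_energy w < m + e]).
have FF : ProperFilter F.
  apply: filter_from_proper => [|e e0]; last first.
    by have [w we] := near_min e e0; exists w.
  apply: filter_from_filter => [|e e' /= e0 e'0]; first by exists 1 => /=.
  exists (Num.min e e') => /=; first by rewrite lt_min e0.
  move=> w /= we; split=> /=; apply: lt_le_trans we _; rewrite lerD2l.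
    by rewrite ge_min lexx.
  by rewrite ge_min lexx orbT.
(* The midpoint has energy at least [m], which leaves less than [e] for the defect
   [8^-1 * b (x - w) (x - w)]. *)
have close e x w : quad_energy x < m + e -> quad_energy w < m + e ->
    alpha * `|x - w| ^+ 2 < 8 * e.
  move=> xe we; have := mE (2^-1 *: (x + w)); have := b_coercive (x - w).
  by rewrite quad_energy_midpoint; lra.
have Fcauchy : cauchy F.
  apply: cauchy_exP => e e0; pose r := alpha * e ^+ 2 / 8.
  have r0 : 0 < r by rewrite divr_gt0// mulr_gt0// exprn_gt0.
  have [x xr] := near_min r r0; exists x, r => // w /= wr.
  rewrite -ball_normE /=; have := close r x w xr wr.
  have -> : 8 * r = alpha * e ^+ 2 by rewrite /r; field.
  by rewrite ltr_pM2l// ltr_pXn2r// nnegrE ?normr_ge0// ltW.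
have /cauchy_cvgP/cvg_ex[/= u Fu] := Fcauchy.
exists u => w; apply: le_trans (mE w); apply/ler_addgt0Pr => e e0.
(* [c] bounds the slope of the energy at [u]; the [1] makes it positive. Half of [e] pays for the
   near-minimality of [v], half for the slope times the distance from [u] to [v]; the term [b h h]
   has the favourable sign. *)
pose c := `|C| * `|u| + `|K| + 1.
have c0 : 0 < c by rewrite ltr_wpDl// addr_ge0// mulr_ge0.
have : F (ball u (e / (2 * c))).
  by apply: Fu; apply: nbhsx_ballx; rewrite divr_gt0// mulr_gt0.
have : F [set w | quad_energy w < m + e / 2].
  by exists (e / 2) => //=; rewrite divr_gt0.
move=> F1 F2; have [v [/= vm]] := filter_ex (filterI F1 F2).
rewrite -ball_normE /= distrC => uv.
have := quad_energyD u (v - u); rewrite addrC subrK.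
move: uv; set h := v - u => uh Ev.
have ch : c * `|h| < e / 2.
  by move: uh; rewrite ltr_pdivlMr ?mulr_gt0//; lra.
have bh : 0 <= b h h.
  by apply: le_trans (b_coercive h); rewrite mulr_ge0 ?sqr_ge0// ltW.
have buh : - (`|C| * `|u| * `|h|) <= b u h.
  rewrite lerNl (le_trans (ler_norm _))// normrN (le_trans (b_bounded _ _))//.
  by rewrite !ler_wpM2r// ler_norm.
have gh : g h <= `|K| * `|h|.
  rewrite (le_trans (ler_norm _))// (le_trans (g_bounded _))//.
  by rewrite ler_wpM2r// ler_norm.
have := normr_ge0 h; move: ch; rewrite /c !mulrDl mul1r; lra.
Qed.

End quadratic_energy.

Theorem theorem2p3 (R : realType)
  (* the design space, with its convex structure when it carries one *)
  (H : metricType R)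
  (H_nonempty : [set: H] !=set0)
  (H_compact : compact [set: H])
  (H_convex : option (isConvexSpace R H))
  (* the Hilbert spaces *)
  (X : R -> hilbertType R)
  (emb : forall s t : R, {linear X s -> X t})
  (X_scale : hilbert_scale emb)
  (X01_compact : compact_map (emb 0 1))
  (X01_dense : dense (range (emb 0 1)))
  (f : X 1)
  (* the forms *)
  (B : forall d : R, H -> {symmetric (X d)})
  (B_bounded : forall d, 0 <= d -> d < 1 -> forall a, bounded_form (B d a))
  (* the cost *)
  (phi : H -> R)
  (phi_ge0 : forall a, 0 <= phi a)
  (phi_convex : if H_convex is Some c then convex_fun c phi else True)
  (phi_lsc : lower_semicontinuous (EFin \o phi))
  (S1 : exists2 M : R, 0 < M & forall d, 0 <= d -> d < 1 ->
    forall v : X d, `|emb d 1 v| <= M * `|v|)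
  (S2 : forall v : (forall d : R, X d),
    (exists K : R, \forall d \near 0^'+, `|v d| <= K) ->
    (forall d_ : nat -> R, (forall k, 0 < d_ k < 1) -> d_ @ \oo --> 0 ->
       precompact (range (fun k => emb (d_ k) 1 (v (d_ k))))) /\
    cluster (emb d 1 (v d) @[d --> 0^'+]) `<=` range (emb 0 1))
  (B1 : forall d, 0 <= d -> d < 1 -> forall (a_ : nat -> H) (a : H),
    a_ @ \oo --> a ->
    forall v : X d, B d (a_ j) v v @[j --> \oo] --> B d a v v)
  (B2 : exists2 A : R, 0 < A & forall d, 0 <= d -> d < 1 ->
    forall (a : H) (v : X d), `|B d a v v| <= A * `|v| ^+ 2)
  (B3 : exists2 alpha : R, 0 < alpha & forall d, 0 <= d -> d < 1 ->
    forall (a : H) (v : X d), alpha * `|v| ^+ 2 <= B d a v v)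
  (B4 : forall (a_ : R -> H) (a : H), a_ d @[d --> 0^'+] --> a ->
    forall v w : X 0,
    B d (a_ d) (emb 0 d v) (emb 0 d w) - B d a (emb 0 d v) (emb 0 d w)
      @[d --> 0^'+] --> 0)
  (B5 : forall (a : H) (v w : X 0),
    B d a (emb 0 d v) (emb 0 d w) @[d --> 0^'+] --> B 0 a v w)
  (B6 : forall (a : H) (v_ : forall d : R, X d) (v : X 0),
    emb d 1 (v_ d) @[d --> 0^'+] --> emb 0 1 v ->
    ((B 0 a v v)%:E <=
      limf_einf (fun d : R => (B d a (v_ d) (v_ d))%:E) 0^'+)%E)
  (d : R) (d_ge0 : 0 <= d) (d_lt1 : d < 1) :
  exists2 p : H * X d,
    admissible emb f B p &
    forall q : H * X d, admissible emb f B q ->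
      objective f phi p.1 (emb d 1 p.2) <= objective f phi q.1 (emb d 1 q.2).
Proof.
have [M _ bM] := S1; have [alpha alpha0 coercive] := B3.
pose g := inner f \o emb d 1 : {scalar (X d)}.
have gK v : `|g v| <= `|f| * M * `|v|.
  rewrite (le_trans (inner_le_norm _ _))// -mulrA.
  by rewrite ler_wpM2l// bM.
have /choice[u umin] (a : H) : exists v : X d, argmin (energy emb f B a) v.
  have [C bC] := B_bounded d d_ge0 d_lt1 a.
  exact: (argmin_quad_energy_nonempty bC gK alpha0 (coercive d d_ge0 d_lt1 a)).
have euler a v : argmin (energy emb f B a) v -> B d a v v = g v.
  exact: (@argmin_quad_energy _ _ (B d a) g).
pose F a := g (u a) + phi a.
have lscF : lower_semicontinuous (EFin \o F).
  move=> a c /=; rewrite lte_fin => cF.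
  (* Half of the gap is for [phi], half for the form at the fixed vector [u a]. *)
  pose e := (F a - c) / 2.
  have e0 : 0 < e by rewrite divr_gt0// subr_gt0.
  have [V aV phiV] : exists2 V, nbhs a V & forall y, V y -> phi a - e < phi y.
    have [|V aV phiV] := phi_lsc a (phi a - e).
      by rewrite /= lte_fin; lra.
    by exists V => // y /phiV; rewrite /= lte_fin.
  have Bu : \forall y \near a, B d y (u a) (u a) < B d a (u a) (u a) + e.
    apply: near_cvg_seq => s sa.
    by apply: (cvgr_lt _ (B1 d d_ge0 d_lt1 _ _ sa (u a))); lra.
  exists (V `&` [set y | B d y (u a) (u a) < B d a (u a) (u a) + e]).
    exact: filterI.
  move=> y [/phiV phiy /= By]; rewrite lte_fin.
  (* With [u a] as competitor for the design [y], the Euler identity gives [g (u y) >= 2 * g (u a) -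
     B d y (u a) (u a)]. *)
  have := umin y (u a); rewrite /energy -!/(g _).
  move: By; rewrite (euler _ _ (umin a)) (euler _ _ (umin y)).
  by move: phiy; rewrite /e /F; lra.
have [a amin] := lower_semicontinuous_compact_min H_nonempty H_compact lscF.
exists (a, u a) => [|[a' v] /=]; first exact: umin.
rewrite /admissible /= => v_min.
apply: le_trans (amin a') _.
(* The state [v] is a priori not the chosen [u a']. A minimizer has energy [- g / 2], so comparing
   energies compares costs. *)
change (g (u a') + phi a' <= g v + phi a').
have := umin a' v; have := v_min (u a'); rewrite /energy -!/(g _).
by rewrite (euler _ _ (umin a')) (euler _ _ v_min); lra.
Qed.
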